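(* For every proper subvariety $\mathcal V$ of $\mathcal M$ there is an integer $s\geq1$ such that $\mathcal V$ satisfies $x^s\approx x^{s+1}$. In particular, every proper subvariety of $\mathcal M$ is locally finite.
   Context: An additively idempotent semiring (ai-semiring) is an algebra $(S,+,\cdot)$ of signature $(2,2)$, without constants, such that $(S,+)$ is a commutative idempotent semigroup, $(S,\cdot)$ is a semigroup, and multiplication distributes over addition. All varieties are in the signature $(2,2)$. $\mathbf N$ is the ai-semiring on the nonnegative integers $\mathbb N_0$ whose semiring addition is $\max$ and whose semiring multiplication is numerical addition; $\mathcal M=\mathsf V(\mathbf N)$ is the variety it generates. In identities, juxtaposition and powers refer to the semiring multiplication. A variety is locally finite if each of its finitely generated members is finite. *)

(* Defs.v *)
From mathcomp Require Import all_boot.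
From mathcomp Require Import boolp classical_sets functions cardinality.

Set Implicit Arguments.
Unset Strict Implicit.
Unset Printing Implicit Defensive.

Local Open Scope classical_set_scope.

(* Nonempty carriers, as usual in universal algebra. *)
Record algebra := Algebra {
  carrier :> Type;
  add : carrier -> carrier -> carrier;
  mul : carrier -> carrier -> carrier;
  carrier_inhabited : inhabited carrier }.

Record is_ai_semiring (A : algebra) : Prop := {
  ai_addA : associative (@add A);
  ai_addC : commutative (@add A);
  ai_addI : idempotent_op (@add A);
  ai_mulA : associative (@mul A);
  ai_mulDl : left_distributive (@mul A) (@add A);
  ai_mulDr : right_distributive (@mul A) (@add A) }.

Definition is_hom (A B : algebra) (f : A -> B) : Prop :=
  morphism_2 f (@add A) (@add B) /\ morphism_2 f (@mul A) (@mul B).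

Lemma prod_inhabited (I : Type) (F : I -> algebra) :
  inhabited (forall i, F i).
Proof.
constructor => i.
by apply: (projT1 (cid (_ : exists x : F i, True))); have [x] := carrier_inhabited (F i); exists x.
Qed.

Definition prod_algebra (I : Type) (F : I -> algebra) : algebra :=
  @Algebra (forall i, F i)
    (fun x y i => add (x i) (y i)) (fun x y i => mul (x i) (y i))
    (prod_inhabited F).

(* Subalgebras are taken up to isomorphism, as domains of injective
   homomorphisms; the index type of a product may be empty. *)
Record is_variety (K : set algebra) : Prop := {
  variety_image : forall (A B : algebra) (f : A -> B),
    is_hom f -> range f = [set: B] -> K A -> K B;
  variety_sub : forall (A B : algebra) (f : B -> A),
    is_hom f -> injective f -> K A -> K B;
  variety_prod : forall (I : Type) (F : I -> algebra),
    (forall i, K (F i)) -> K (prod_algebra F) }.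

Definition generated_variety (K : set algebra) : set algebra :=
  smallest is_variety K.

Definition Nmax : algebra := @Algebra nat maxn addn (inhabits 0).

Definition M : set algebra := generated_variety [set Nmax].

Inductive term : Type :=
| Var of nat
| Add of term & term
| Mul of term & term.

Fixpoint eval (A : algebra) (v : nat -> A) (t : term) : A :=
  match t with
  | Var n => v n
  | Add t1 t2 => add (eval v t1) (eval v t2)
  | Mul t1 t2 => mul (eval v t1) (eval v t2)
  end.

(* The power [t ^ n] for [n >= 1]; there is no unit, and the value at [n = 0]
   is the junk value [t]. *)
Definition term_pow (t : term) (n : nat) : term := iterop n Mul t t.

Definition satisfies (K : set algebra) (t u : term) : Prop :=
  forall A, K A -> forall v : nat -> A, eval v t = eval v u.

Definition subuniverse (A : algebra) (B : set A) : Prop :=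
  forall x y, B x -> B y -> B (add x y) /\ B (mul x y).

Definition finitely_generated (A : algebra) : Prop :=
  exists2 G : set A, finite_set G & smallest (@subuniverse A) G = [set: A].

Definition locally_finite (K : set algebra) : Prop :=
  forall A, K A -> finitely_generated A -> finite_set [set: A].

Lemma Nmax_ai_semiring : is_ai_semiring Nmax.
Proof.
split; [exact: maxnA|exact: maxnC|exact: maxnn|exact: addnA| |].
- by move=> x y z /=; rewrite addn_maxl.
- by move=> x y z /=; rewrite addn_maxr.
Qed.

Lemma generated_variety_is_variety (K : set algebra) :
  is_variety (generated_variety K).
Proof.
split.
- move=> A B f hf sf KA V [vV KV]; exact: (variety_image vV hf sf (KA V (conj vV KV))).
- move=> A B f hf jf KA V [vV KV]; exact: (variety_sub vV hf jf (KA V (conj vV KV))).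
- move=> I F KF V [vV KV]; apply: (variety_prod vV) => i.
  exact: (KF i V (conj vV KV)).
Qed.

Lemma ai_semirings_variety : is_variety is_ai_semiring.
Proof.
split.
- move=> A B f [fD fM] sf [aA aC aI mA dl dr].
  have sur b : exists a, f a = b.
    by have : [set: B] b by []; rewrite -sf => -[a _ <-]; exists a.
  split.
  + move=> x y z; have [a <-] := sur x; have [b <-] := sur y.
    by have [c <-] := sur z; rewrite -!fD aA.
  + by move=> x y; have [a <-] := sur x; have [b <-] := sur y; rewrite -!fD aC.
  + by move=> x; have [a <-] := sur x; rewrite -fD aI.
  + move=> x y z; have [a <-] := sur x; have [b <-] := sur y.
    by have [c <-] := sur z; rewrite -!fM mA.
  + move=> x y z; have [a <-] := sur x; have [b <-] := sur y.
    by have [c <-] := sur z; rewrite -!(fD, fM) dl.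
  + move=> x y z; have [a <-] := sur x; have [b <-] := sur y.
    by have [c <-] := sur z; rewrite -!(fD, fM) dr.
- move=> A B f [fD fM] jf [aA aC aI mA dl dr].
  split=> [x y z|x y|x|x y z|x y z|x y z]; apply: jf; rewrite !(fD, fM) //.
- move=> I F KF; split=> [x y z|x y|x|x y z|x y z|x y z];
    apply: functional_extensionality_dep => i /=; case: (KF i) => // *.
Qed.

Lemma M_ai_semiring (A : algebra) : M A -> is_ai_semiring A.
Proof.
apply; split; first exact: ai_semirings_variety.
by move=> _ ->; exact: Nmax_ai_semiring.
Qed.

(* Main.v *)
Require Import Defs.
From mathcomp Require Import all_boot.
From mathcomp Require Import boolp classical_sets functions cardinality.

(** A proper subvariety [V] of [M] cannot contain [Nmax], which generates [M],
so it is enough to build [Nmax] inside any subvariety that satisfies none of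
the identities [x^s = x^{s+1}].

Every identity of [Nmax] holds throughout [M]; in particular
[x^m + x^n = x^(max m n)] does. Hence the powers of any element form a chain,
and two equal powers force all powers in between to be equal. If
[x^s = x^{s+1}] fails at [a_s] in [A_s], for each [s], then all the powers of
[a = (a_s)_s] in the product of the [A_s] are distinct, and they form a copy of
the positive part of [Nmax] ([Posmax_sub_prod]).

The number 0 is then recovered by slopes. In a countable power of the positive
part, consider the sequences that stay at bounded distance from a sequence
[n |-> k n]. They form a subalgebra, and the slope [k], which may well be 0, is
compatible with [max] and [+]; so [Nmax] is a homomorphic image of that
subalgebra ([Nmax_of_Posmax]).

For local finiteness, note that both operations are associative and
commutative, that multiplication satisfies [x^s = x^{s+1}], and that addition
satisfies its analogue for [s = 1] by idempotence. A finitely generated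
commutative semigroup with such an identity is finite
([finite_semigroup_closure]). Close the generators under multiplication and the
result under addition: by distributivity the
second closure is still closed under multiplication, so it is the whole
algebra ([finite_generated]). *)

Local Open Scope classical_set_scope.

Set Implicit Arguments.
Unset Strict Implicit.

(** * Identities of M *)

Definition eq_class (t u : term) : set algebra :=
  [set A : algebra | forall v : nat -> A, eval v t = eval v u].

Lemma eval_hom (A B : algebra) (f : A -> B) (v : nat -> A) t :
  is_hom f -> eval (f \o v) t = f (eval v t).
Proof. by case=> fD fM; elim: t => //= t -> u ->; rewrite ?fD ?fM. Qed.

Lemma eval_prod (I : Type) (F : I -> algebra) (v : nat -> prod_algebra F) t i :
  eval v t i = eval (fun n => v n i) t.
Proof. by elim: t => //= t -> u ->. Qed.

Lemma eq_class_variety t u : is_variety (eq_class t u).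
Proof.
split.
- move=> A B f hf sf hA v.
  have pre n : exists a, f a = v n.
    have : range f (v n) by rewrite sf.
    by case=> a _ fa; exists a.
  have [w wP] := choice pre.
  have <- : f \o w = v by apply: funext.
  by rewrite !eval_hom // hA.
- by move=> A B f hf jf hA v; apply: jf; rewrite -!eval_hom.
- move=> I F hF v; apply: functional_extensionality_dep => i.
  by rewrite !eval_prod; exact: hF.
Qed.

Lemma M_identity t u :
  (forall v : nat -> Nmax, eval v t = eval v u) -> satisfies M t u.
Proof.
move=> tu A /(_ (eq_class t u)); apply; split; first exact: eq_class_variety.
by move=> _ ->.
Qed.

Lemma M_mulC (A : algebra) : M A -> commutative (@Defs.mul A).
Proof.
move=> MA x y; pose v n := if n is 0 then x else y.
have /(_ A MA v) : satisfies M (Mul (Var 0) (Var 1)) (Mul (Var 1) (Var 0)).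
  by apply: M_identity => w; exact: addnC.
by [].
Qed.

(** * Powers *)

(** The power with exponent [n.+1]: the shift avoids the missing unit. *)
Definition powS {T : Type} (op : T -> T -> T) (a : T) (n : nat) : T :=
  iter n (op a) a.

Lemma eval_pow (A : algebra) (v : nat -> A) t n :
  eval v (term_pow t n.+1) = powS (@Defs.mul A) (eval v t) n.
Proof.
by rewrite /term_pow iteropS /powS; elim: n => //= n ->.
Qed.

Lemma powS_Nmax (a : Nmax) n : powS (@Defs.mul Nmax) a n = (n.+1 * a)%N.
Proof. by rewrite /powS; elim: n => [|n /= ->]; rewrite ?mul1n ?[RHS]mulSn. Qed.

Lemma powS_op (T : Type) (op : T -> T -> T) (a : T) m n : associative op ->
  op (powS op a m) (powS op a n) = powS op a (m + n).+1.
Proof. by move=> opA; elim: m => //= m IH; rewrite -opA IH. Qed.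

Lemma M_powS_add (A : algebra) (a : A) m n : M A ->
  Defs.add (powS (@Defs.mul A) a m) (powS (@Defs.mul A) a n) =
    powS (@Defs.mul A) a (maxn m n).
Proof.
move=> MA; pose x := Var 0; pose t := Add (term_pow x m.+1) (term_pow x n.+1).
have /(_ A MA (fun=> a)) : satisfies M t (term_pow x (maxn m n).+1).
  by apply: M_identity => v /=; rewrite !eval_pow !powS_Nmax -maxnMl maxnSS.
by rewrite /= !eval_pow.
Qed.

(** The powers form a chain, so [powS a m.+1] lies between the equal elements
[powS a m] and [powS a n]. *)
Lemma M_powS_collapse (A : algebra) (a : A) m n : M A -> (m < n)%N ->
  powS (@Defs.mul A) a m = powS (@Defs.mul A) a n ->
  powS (@Defs.mul A) a m = powS (@Defs.mul A) a m.+1.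
Proof.
move=> MA mn e; rewrite -[in RHS](maxn_idPl (leqnSn m)) -M_powS_add // e.
by rewrite M_powS_add // (maxn_idPr mn).
Qed.

(** * Recovering Nmax from an unbounded chain of powers *)

(** The positive part of [Nmax]: the element [m] stands for the number
[m.+1]. *)
Definition Posmax : algebra :=
  @Algebra nat maxn (fun m n => (m + n).+1) (inhabits 0).

(** In the component indexed by the smaller of two exponents, equality of the
two powers would collapse consecutive powers, which is excluded there. *)
Lemma Posmax_sub_prod (A : nat -> algebra) (a : forall s, A s) :
  (forall s, M (A s)) ->
  (forall s, powS (@Defs.mul (A s)) (a s) s <>
    powS (@Defs.mul (A s)) (a s) s.+1) ->
  exists f : Posmax -> prod_algebra A, is_hom f /\ injective f.
Proof.
move=> MA neq; exists (fun m s => powS (@Defs.mul (A s)) (a s) m); split.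
  split=> m n; apply: functional_extensionality_dep => s /=.
    by rewrite M_powS_add.
  by rewrite powS_op //; exact: ai_mulA (M_ai_semiring (MA s)).
move=> m n e; have es s := congr1 (fun g => g s) e.
have [mn|nm|//] := ltngtP m n.
  by case: (neq m); exact: M_powS_collapse mn (es m).
by case: (neq n); apply: M_powS_collapse nm _ => //; rewrite es.
Qed.

Definition has_slope (f : nat -> nat) (k : nat) : Prop :=
  exists c, forall n, (k * n <= f n <= k * n + c)%N.

Lemma has_slope_inj f k l : has_slope f k -> has_slope f l -> k = l.
Proof.
wlog kl : k l / (k < l)%N => [hw fk fl|[c fk] [d fl]].
  by have [kl|lk|//] := ltngtP k l; [|apply/esym]; apply: hw.
(* The value at c.+1 is at most k * c.+1 + c, which is less than l * c.+1. *)
have /andP[_ le1] := fk c.+1; have /andP[le2 _] := fl c.+1.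
have : ((k.+1 * c.+1) <= k * c.+1 + c)%N.
  by apply: leq_trans le1; apply: leq_trans le2; rewrite leq_mul2r kl orbT.
by rewrite mulSn addnC leq_add2l ltnn.
Qed.

Lemma has_slope_max f g k l : has_slope f k -> has_slope g l ->
  has_slope (fun n => maxn (f n) (g n)) (maxn k l).
Proof.
move=> [c fk] [d gl]; exists (maxn c d) => n.
have /andP[f1 f2] := fk n; have /andP[g1 g2] := gl n.
rewrite maxnMl !geq_max !leq_max f1 g1 orbT /=.
by rewrite (leq_trans f2) ?(leq_trans g2) ?leq_add ?leq_maxl ?leq_maxr.
Qed.

Lemma has_slope_add f g k l : has_slope f k -> has_slope g l ->
  has_slope (fun n => (f n + g n).+1) (k + l).
Proof.
move=> [c fk] [d gl]; exists (c + d).+1 => n.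
have /andP[f1 f2] := fk n; have /andP[g1 g2] := gl n.
rewrite mulnDl addnS ltnS addnACA leq_add // andbT.
by rewrite leqW // leq_add.
Qed.

Lemma has_slope_linear k : has_slope (muln k) k.
Proof. by exists 0 => n; rewrite addn0 leqnn. Qed.

Definition sloped : Type := {p : (nat -> nat) * nat | has_slope p.1 p.2}.

(** The slope is carried along with the sequence, although it is determined by
it, so that it can be read off without choice. *)
Definition slope_algebra : algebra :=
  @Algebra sloped
    (fun x y => exist _ (_, _) (has_slope_max (svalP x) (svalP y)))
    (fun x y => exist _ (_, _) (has_slope_add (svalP x) (svalP y)))
    (inhabits (exist _ (_, _) (has_slope_linear 0))).

(** Forgetting the slope embeds [slope_algebra] in a power of [Posmax];
forgetting the sequence maps it onto [Nmax]. *)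
Lemma Nmax_of_Posmax (V : set algebra) : is_variety V -> V Posmax -> V Nmax.
Proof.
move=> VV VP.
pose seqs : slope_algebra -> prod_algebra (fun _ : nat => Posmax) :=
  fun x => (sval x).1.
pose slope : slope_algebra -> Nmax := fun x => (sval x).2.
have hslope : is_hom slope by [].
have sslope : range slope = [set: Nmax].
  apply/seteqP; split=> // k _.
  by exists (exist _ (_, _) (has_slope_linear k)).
apply: (variety_image VV hslope sslope).
have hseqs : is_hom seqs by [].
apply: (variety_sub VV hseqs); last by apply: (variety_prod VV).
move=> [[f k] /= fk] [[g l] /= gl]; rewrite /seqs /= => fg.
apply: eq_exist => /=; rewrite fg in fk *.
by rewrite (has_slope_inj fk gl).
Qed.

Lemma proper_subvariety_powers (V : set algebra) :
  is_variety V -> V `<` M ->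
  exists s, forall A : algebra, V A -> forall a : A,
    powS (@Defs.mul A) a s = powS (@Defs.mul A) a s.+1.
Proof.
move=> VV [VM nMV]; apply: contrapT => hN; apply: nMV => B; apply; split=> //.
move=> _ ->; apply: Nmax_of_Posmax => //.
have bad s : exists Aa : {A : algebra & A}, V (projT1 Aa) /\
    powS (@Defs.mul _) (projT2 Aa) s <> powS (@Defs.mul _) (projT2 Aa) s.+1.
  apply: contrapT => h; apply: hN; exists s => A VA a.
  by apply: contrapT => ne; apply: h; exists (existT _ A a).
have [F FP] := choice bad.
have VF s : V (projT1 (F s)) by case: (FP s).
have MF s : M (projT1 (F s)) by exact: VM.
have [f [hf jf]] := Posmax_sub_prod MF (fun s => proj2 (FP s)).
by apply: (variety_sub VV hf jf); apply: (variety_prod VV).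
Qed.

(** * Local finiteness *)

Definition op_closed {T : Type} (op : T -> T -> T) (C : set T) : Prop :=
  forall x y, C x -> C y -> C (op x y).

Lemma smallest_op_closed (T : Type) (op : T -> T -> T) (G : set T) :
  op_closed op (smallest (op_closed op) G).
Proof. by move=> x y hx hy C CG; apply: CG.1; [exact: hx|exact: hy]. Qed.

Lemma op_closed_join (T : Type) (op : T -> T -> T) (C D : set T) :
  associative op -> commutative op -> op_closed op C -> op_closed op D ->
  op_closed op (C `|` D `|` [set op x y | x in C & y in D]).
Proof.
move=> opA opC hC hD.
have opCA x y z : op x (op y z) = op y (op x z) by rewrite !opA (opC x).
have CD x y : C x -> D y -> [set op x y | x in C & y in D] (op x y).
  by move=> Cx Dy; exists x => //; exists y.
move=> u v [[Cu|Du]|[x Cx [x' Dx <-]]] [[Cv|Dv]|[y Cy [y' Dy <-]]].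
- by left; left; apply: hC.
- by right; apply: CD.
- by right; rewrite opA; apply: CD => //; apply: hC.
- by right; rewrite opC; apply: CD.
- by left; right; apply: hD.
- by right; rewrite opCA; apply: CD => //; apply: hD.
- by right; rewrite opC opA; apply: CD => //; apply: hC.
- by right; rewrite -opA; apply: CD => //; apply: hD.
- by right; rewrite -opA (opCA x') opA; apply: CD; [apply: hC|apply: hD].
Qed.

Lemma powS_stable (T : Type) (op : T -> T -> T) (a : T) s n :
  powS op a s = powS op a s.+1 -> powS op a n = powS op a (minn n s).
Proof.
move=> e; have [//|sn] := leqP n s.
rewrite -(subnK (ltnW sn)); elim: (n - s) => //= k IH.
by rewrite -[RHS]/(powS op a s) e /powS /= -/(powS op a s) -IH.
Qed.

(** Adding one generator [g] to a finite subsemigroup [C] keeps it finite: by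
commutativity each product is [c], [g^i] or [c g^i], and there are finitely
many powers [g^i]. *)
Lemma finite_semigroup_closure (T : Type) (op : T -> T -> T) s (G : set T) :
  associative op -> commutative op ->
  (forall a, powS op a s = powS op a s.+1) ->
  finite_set G -> finite_set (smallest (op_closed op) G).
Proof.
move=> opA opC hs.
move=> /(@finite_seqP {classic T})[l ->].
suff [C finC [clC lC]] : exists2 C : set T, finite_set C &
    op_closed op C /\ [set` l] `<=` C.
  by apply: sub_finite_set finC; apply: smallest_sub.
elim: l => [|g l [C finC [clC lC]]].
  by exists set0; [exact: finite_set0|split=> [x y []|x]].
pose D : set T := [set powS op g i | i in `I_s.+1].
have clD : op_closed op D.
  move=> _ _ [i _ <-] [j _ <-]; rewrite powS_op // (powS_stable _ (hs g)) //.
  by exists (minn (i + j).+1 s) => //=; rewrite ltnS geq_minr.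
exists (C `|` D `|` [set op x y | x in C & y in D]).
  have finD : finite_set D by apply: finite_image; exact: finite_II.
  by rewrite !finite_setU; do ![split]; last exact: finite_image2.
split; first exact: op_closed_join.
move=> x /=; rewrite inE => /orP[/eqP ->|xl]; left.
  by right; exists 0.
by left; apply: lC.
Qed.

(** The additive closure [Q] of the multiplicative closure [P] consists of the
finite sums of products of generators; distributivity makes it closed under
multiplication. *)
Lemma finite_generated (A : algebra) s : is_ai_semiring A ->
  commutative (@Defs.mul A) ->
  (forall a : A, powS (@Defs.mul A) a s = powS (@Defs.mul A) a s.+1) ->
  finitely_generated A -> finite_set [set: A].
Proof.
move=> [aA aC aI mA dl dr] mC hs [G finG <-].
pose P := smallest (op_closed (@Defs.mul A)) G.
pose Q := smallest (op_closed (@Defs.add A)) P.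
have finQ : finite_set Q.
  apply: (finite_semigroup_closure (s := 0)) => // [a|].
    by rewrite /powS /= aI.
  exact: finite_semigroup_closure finG.
apply: sub_finite_set finQ; apply: smallest_sub; last first.
  by move=> g Gg; do 2![apply: sub_gen_smallest].
have clQ : op_closed (@Defs.add A) Q by exact: smallest_op_closed.
have PQ p y : P p -> Q y -> Q (Defs.mul p y).
  move=> Pp; suff : Q `<=` [set y | Q (Defs.mul p y)] by apply.
  apply: smallest_sub => [z w Qz Qw|q Pq] /=; first by rewrite dr; apply: clQ.
  by apply: sub_gen_smallest; apply: smallest_op_closed.
move=> x y Qx Qy; split; first exact: clQ.
suff : Q `<=` [set x | Q (Defs.mul x y)] by apply.
apply: smallest_sub => [z w Qz Qw|p Pp] /=; last exact: PQ.
by rewrite dl; apply: clQ.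
Qed.

Unset Implicit Arguments.

Theorem theorem6p5 (V : set algebra) (V_variety : is_variety V)
    (V_proper : V `<` M) :
  (exists s : nat, (1 <= s)%N /\
     satisfies V (term_pow (Var 0) s) (term_pow (Var 0) s.+1)) /\
  locally_finite V.
Proof.
have [s hs] := proper_subvariety_powers V_variety V_proper.
split.
  by exists s.+1; split=> // A VA v; rewrite !eval_pow; exact: hs.
move=> A VA; have MA : M A by case: V_proper => VM _; apply: VM.
exact: (finite_generated (M_ai_semiring MA) (M_mulC MA) (hs A VA)).
Qed.
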